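(* Let $\mathcal{A}$ be a (nonempty) compact IRU-set of non-negative real $(N\times M)$-matrices and let $\mathcal{B}$ be a (nonempty) compact IRU-set of non-negative real $(M\times N)$-matrices. Then $$\min_{A\in\mathcal{A}}\max_{B\in\mathcal{B}}\rho(AB)=\max_{B\in\mathcal{B}}\min_{A\in\mathcal{A}}\rho(AB).$$
   Context: $\rho(X)$ denotes the spectral radius of a square matrix $X$ (maximal modulus of its eigenvalues). A matrix is non-negative if all its entries are $\ge 0$. Given $N$ nonempty sets $\mathcal{A}_1,\dots,\mathcal{A}_N$ of $M$-dimensional row vectors, the IRU-set (independent row uncertainty set) formed by them is the set $\mathcal{A}$ of all $(N\times M)$-matrices whose $i$-th row belongs to $\mathcal{A}_i$ for every $i=1,\dots,N$. A set of matrices is an IRU-set if it is formed in this way by some row sets. *)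

(* Defs.v *)
From HB Require Import structures.
From mathcomp Require Import all_boot all_order all_algebra.
From mathcomp Require Import all_classical all_reals all_analysis.
From mathcomp Require Export complex.
Set Implicit Arguments.
Unset Strict Implicit.
Unset Printing Implicit Defensive.
Import Order.TTheory GRing.Theory Num.Theory.
Import numFieldNormedType.Exports.
Local Open Scope classical_set_scope.
Local Open Scope ring_scope.

Definition is_max (R : realType) (S : set R) (v : R) : Prop :=
  S v /\ ubound S v.

Definition is_min (R : realType) (S : set R) (v : R) : Prop :=
  S v /\ lbound S v.

Definition has_max (R : realType) (S : set R) : Prop := exists v, is_max S v.

Definition has_min (R : realType) (S : set R) : Prop := exists v, is_min S v.

(* Junk value 0 when the extremum is not attained; see [has_max], [has_min]. *)
Definition set_max (R : realType) (S : set R) : R := xget 0 (is_max S).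

Definition set_min (R : realType) (S : set R) : R := xget 0 (is_min S).

Lemma set_maxE (R : realType) (S : set R) (v : R) :
  is_max S v -> set_max S = v.
Proof.
move=> Sv; apply: xget_unique => // w [Sw ubw].
by apply/eqP; rewrite eq_le ubw ?(Sv.2 _ Sw) //; exact: Sv.1.
Qed.

Lemma set_minE (R : realType) (S : set R) (v : R) :
  is_min S v -> set_min S = v.
Proof.
move=> Sv; apply: xget_unique => // w [Sw lbw].
by apply/eqP; rewrite eq_le lbw ?(Sv.2 _ Sw) //; exact: Sv.1.
Qed.

(* The eigenvalues of the real matrix X are its complex ones, so X is first
   mapped into R[i]. *)
Definition spectral_radius (R : realType) (n : nat) (X : 'M[R]_n) : R :=
  set_max [set ComplexField.Normc.normc z |
            z in [set z : R[i] | eigenvalue (map_mx (real_complex R) X) z]].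

Definition iru_set (R : realType) (N M : nat) (rows : 'I_N -> set 'rV[R]_M) :
    set 'M[R]_(N, M) :=
  [set A | forall i : 'I_N, rows i (row i A)].

Definition is_iru_set (R : realType) (N M : nat) (S : set 'M[R]_(N, M)) : Prop :=
  exists rows : 'I_N -> set 'rV[R]_M,
    (forall i : 'I_N, rows i !=set0) /\ S = iru_set rows.

Definition nonneg_mx (R : realType) (N M : nat) (A : 'M[R]_(N, M)) : Prop :=
  forall (i : 'I_N) (j : 'I_M), 0 <= A i j.

(* Main.v *)
(* A saddle point (A, B) of rho(AB) gives the minimax equality. If A B x = t x
   with x > 0, where B maximizes every coordinate of B x and A minimizes every
   coordinate of A (B x) (possible since rows vary independently), then (A, B) is
   a saddle point by the Collatz-Wielandt bounds. Such an x exists once the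
   constant matrix with entries e > 0 is added to the products; the general case
   follows by letting e tend to 0. Applied to a single matrix, the same limit
   yields the Perron eigenvector, so no continuity of the spectral radius is
   needed. *)
Require Import Defs.
From mathcomp Require Import all_boot all_order all_algebra.
From mathcomp Require Import all_classical all_reals all_analysis.
From mathcomp Require Import lra.
Set Implicit Arguments.
Unset Strict Implicit.
Unset Printing Implicit Defensive.
Import Order.TTheory GRing.Theory Num.Theory.
Import numFieldNormedType.Exports.
Local Open Scope classical_set_scope.
Local Open Scope ring_scope.

(** * Continuity and compactness of matrix expressions *)

Lemma continuous_sum (R : realType) (T : topologicalType) (n : nat)
  (f : 'I_n -> T -> R) :
  (forall i, continuous (f i)) -> continuous (fun t => \sum_i f i t).
Proof.
move=> cf; have -> : (fun t => \sum_i f i t) = \sum_i f i by rewrite fct_sumE.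
apply: (big_ind (fun g : T -> R => continuous g)) => // [t|g h cg ch t].
  exact: cvg_cst.
by apply: cvgD; [exact: cg|exact: ch].
Qed.

Lemma continuous_mulmx (R : realType) (T : topologicalType) (m n p : nat)
  (F : T -> 'M[R]_(m, n)) (G : T -> 'M[R]_(n, p)) :
  (forall i j, continuous (fun t => F t i j)) ->
  (forall i j, continuous (fun t => G t i j)) ->
  forall i j, continuous (fun t => (F t *m G t) i j).
Proof.
move=> cF cG i j; under eq_fun do rewrite mxE.
by apply: continuous_sum => k t; apply: cvgM; [exact: cF|exact: cG].
Qed.

Lemma closed_le_continuous (R : realType) (T : topologicalType) (f g : T -> R) :
  continuous f -> continuous g -> closed [set t | f t <= g t].
Proof.
move=> cf cg.
have -> : [set t | f t <= g t] = (fun t => g t - f t) @^-1` [set x | 0 <= x].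
  by apply/seteqP; split=> t /=; rewrite subr_ge0.
apply: preimage_closed; last exact: closed_ge.
by move=> t _; apply: cvgB; [exact: cg|exact: cf].
Qed.

(** Non-negative entries with sum 1 are at most 1, so the simplex is a closed part of a compact
    cube; the equality is split into two inequalities to which [closed_le_continuous] applies. *)
Lemma compact_simplex (R : realType) (n : nat) :
  compact [set x : 'rV[R]_n | nonneg_mx x /\ \sum_i x 0 i = 1].
Proof.
have -> : [set x : 'rV[R]_n | nonneg_mx x /\ \sum_i x 0 i = 1] =
    [set x : 'rV[R]_n | forall i, `[(0 : R), 1]%classic (x ord0 i)] `&`
    ([set x | \sum_i x 0 i <= 1] `&` [set x | 1 <= \sum_i x 0 i]).
  apply/seteqP; split=> x /=.
    move=> [x0 x1]; rewrite x1; split=> // i; rewrite /= in_itv /= x0 -x1.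
    by rewrite (bigD1 i) //= lerDl sumr_ge0.
  move=> [x01 [x1 x2]]; split; last by apply/eqP; rewrite eq_le x1 x2.
  by move=> i j; rewrite ord1; have := x01 j; rewrite /= in_itv /= => /andP[].
have c1 : continuous (fun x : 'rV[R]_n => \sum_i x 0 i).
  by apply: continuous_sum => i; exact: coord_continuous.
apply: compact_closedI.
  by apply: (@rV_compact R n (fun=> `[0, 1]%classic)) => _; exact: segment_compact.
by apply: closedI; apply: closed_le_continuous => //; exact: cst_continuous.
Qed.

(** * Entrywise order on matrices *)

Definition lemx (R : realType) (m n : nat) (A B : 'M[R]_(m, n)) : Prop :=
  forall i j, A i j <= B i j.

Lemma lemx_trans (R : realType) (m n : nat) (A B C : 'M[R]_(m, n)) :
  lemx A B -> lemx B C -> lemx A C.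
Proof. by move=> AB BC i j; apply: le_trans (AB i j) (BC i j). Qed.

Lemma lemx_mul2l (R : realType) (m n p : nat) (A : 'M[R]_(m, n))
  (B C : 'M[R]_(n, p)) : nonneg_mx A -> lemx B C -> lemx (A *m B) (A *m C).
Proof.
by move=> A0 BC i j; rewrite !mxE ler_sum // => k _; rewrite ler_wpM2l.
Qed.

Lemma lemx_mul2r (R : realType) (m n p : nat) (A : 'M[R]_(n, p))
  (B C : 'M[R]_(m, n)) : nonneg_mx A -> lemx B C -> lemx (B *m A) (C *m A).
Proof.
by move=> A0 BC i j; rewrite !mxE ler_sum // => k _; rewrite ler_wpM2r.
Qed.

Lemma nonneg_mulmx (R : realType) (m n p : nat) (A : 'M[R]_(m, n))
  (B : 'M[R]_(n, p)) : nonneg_mx A -> nonneg_mx B -> nonneg_mx (A *m B).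
Proof. by move=> A0 B0 i j; rewrite mxE sumr_ge0 // => k _; rewrite mulr_ge0. Qed.

(** * Row-wise optimization over IRU-sets *)

(* Rows can be chosen independently, so a single matrix maximizes every
   coordinate at once. *)
Lemma iru_argmax (R : realType) (m n : nat) (S : set 'M[R]_(m, n))
  (x : 'cV[R]_n) : is_iru_set S -> compact S ->
  exists2 B, S B & forall B', S B' -> lemx (B' *m x) (B *m x).
Proof.
move=> [rows [rows0 SE]] cS.
have S0 : S !=set0.
  have [f fP] := choice rows0.
  by exists (\matrix_i f i); rewrite SE => i; rewrite rowK.
have /choice[f fP] (i : 'I_m) : exists B, S B /\
    forall B', S B' -> (B' *m x) i 0 <= (B *m x) i 0.
  have [|B BS BP] := @compact_EVT_max _ R (fun B : 'M[R]_(m, n) => (B *m x) i 0) S S0 cS.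
    apply: continuous_subspaceT; apply: continuous_mulmx => k l.
      exact: coord_continuous.
    exact: cst_continuous.
  exists B; split; first by rewrite inE in BS.
  by move=> B' SB'; apply: BP; rewrite inE.
exists (\matrix_i row i (f i)).
  by rewrite SE => i; rewrite rowK; have := (fP i).1; rewrite SE; exact.
move=> B' SB' i j; rewrite ord1.
have -> : (\matrix_i row i (f i) *m x) i 0 = (f i *m x) i 0.
  by rewrite !mxE; apply: eq_bigr => k _; rewrite !mxE.
exact: (fP i).2.
Qed.

(** Minimizing [B *m x] amounts to maximizing [B *m (- x)]. *)
Lemma iru_argmin (R : realType) (m n : nat) (S : set 'M[R]_(m, n))
  (x : 'cV[R]_n) : is_iru_set S -> compact S ->
  exists2 B, S B & forall B', S B' -> lemx (B *m x) (B' *m x).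
Proof.
move=> iS cS; have [B SB BP] := iru_argmax (- x) iS cS.
by exists B => // B' /BP + i j => /(_ i j); rewrite !mulmxN !mxE lerN2.
Qed.

(** Reducing one of the two sets to a point yields the inner extrema; reducing both yields the
    Perron eigenvector. *)
Lemma is_iru_set1 (R : realType) (m n : nat) (A : 'M[R]_(m, n)) :
  is_iru_set [set A].
Proof.
exists (fun i => [set row i A]); split=> [i|]; first by exists (row i A).
apply/seteqP; split=> [B -> //|B BA /=]; apply/row_matrixP => i.
exact: BA.
Qed.

(** * Saddle point of the perturbed problem *)

Lemma mul_const_mx_cV (R : realType) (m n : nat) (e : R) (x : 'cV[R]_n)
  (i : 'I_m) (j : 'I_1) : (const_mx e *m x) i j = e * \sum_k x k 0.
Proof. by rewrite mxE mulr_sumr; apply: eq_bigr => k _; rewrite mxE ord1. Qed.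

(** Since the entries of [x] are at most 1, [B *m x] is dominated by the largest row sums over [cB];
    adding up the coordinate inequalities for one fixed [A0] then bounds [t]. The bound is uniform
    in [e], so a single compact set serves the whole limit. *)
Lemma superlevel_bounded (R : realType) (N M : nat)
  (cA : set 'M[R]_(N, M)) (cB : set 'M[R]_(M, N))
  (iruA : is_iru_set cA) (iruB : is_iru_set cB)
  (compactA : compact cA) (compactB : compact cB)
  (nonnegA : forall A, cA A -> nonneg_mx A)
  (nonnegB : forall B, cB B -> nonneg_mx B) :
  exists T : R, forall (e t : R) (x : 'cV[R]_N) B,
    e <= 1 -> nonneg_mx x -> \sum_i x i 0 = 1 -> cB B ->
    (forall A, cA A -> lemx (t *: x) ((A *m B + const_mx e) *m x)) -> t <= T.
Proof.
have [B1 _ B1P] := iru_argmax (const_mx 1 : 'cV_N) iruB compactB.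
(* Optimizing against the zero vector merely picks an element of [cA]. *)
have [A0 cA0 _] := iru_argmax (0 : 'cV_M) iruA compactA.
exists (\sum_i ((A0 *m (B1 *m (const_mx 1 : 'cV_N))) i 0 + 1)) => e t x B e1 x0 x1 cBB.
move=> /(_ _ cA0) tx.
rewrite -[t]mulr1 -{1}x1 mulr_sumr ler_sum // => i _.
have := tx i 0; rewrite mxE => /le_trans; apply.
rewrite mulmxDl mxE mul_const_mx_cV x1 mulr1 lerD // -mulmxA.
apply: lemx_mul2l; first exact: nonnegA.
apply: lemx_trans (B1P _ cBB); apply: lemx_mul2l; first exact: nonnegB.
move=> k l; rewrite [l]ord1 mxE -x1 (bigD1 k) //= lerDl sumr_ge0 //.
Qed.

(* Collatz-Wielandt argument: at a maximizer [(x, B, t)] of [t] over the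
   superlevel conditions, the image [y] of [x] under the min-max operator is
   [t *: x], since otherwise strict monotonicity of the perturbed operator makes
   [y] beat [t]. *)
Lemma perturbed_saddle (R : realType) (N M : nat) (hN : (0 < N)%N)
  (cA : set 'M[R]_(N, M)) (cB : set 'M[R]_(M, N))
  (iruA : is_iru_set cA) (iruB : is_iru_set cB)
  (compactA : compact cA) (compactB : compact cB)
  (nonnegA : forall A, cA A -> nonneg_mx A)
  (nonnegB : forall B, cB B -> nonneg_mx B) (e : R) :
  0 < e -> e <= 1 ->
  exists A B (x : 'cV[R]_N) (t : R),
    [/\ [/\ cA A, cB B & 0 <= t],
        forall i, 0 < x i 0,
        \sum_i x i 0 = 1 &
        (A *m B + const_mx e) *m x = t *: x] /\
    (forall A', cA A' -> lemx (A *m B *m x) (A' *m B *m x)) /\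
    (forall B', cB B' -> lemx (B' *m x) (B *m x)).
Proof.
move=> e0 e1.
have [T TP] := superlevel_bounded iruA iruB compactA compactB nonnegA nonnegB.
pose S := [set x : 'rV[R]_N | nonneg_mx x /\ \sum_i x 0 i = 1].
(* The vector is kept as a row, and [q] pairs a matrix of [cA] with a coordinate, so that [K] is a
   compact product cut out by closed scalar inequalities. *)
pose K := (S `*` cB `*` `[0, T]%classic) `&`
  \bigcap_(q in [set q : 'M[R]_(N, M) * 'I_N | cA q.1])
    [set p : 'rV[R]_N * 'M[R]_(M, N) * R |
      p.2 * p.1.1 0 q.2 <= ((q.1 *m p.1.2 + const_mx e) *m p.1.1^T) q.2 0].
have cf1 i j : continuous (fun p : 'rV[R]_N * 'M[R]_(M, N) * R => p.1.1 i j).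
  move=> p; apply: (continuous_comp (f := fun p : 'rV[R]_N * 'M[R]_(M, N) * R => p.1.1)
      (g := fun x : 'rV[R]_N => x i j)); last exact: coord_continuous.
  by apply: continuous_comp; exact: cvg_fst.
have cf2 i j : continuous (fun p : 'rV[R]_N * 'M[R]_(M, N) * R => p.1.2 i j).
  move=> p; apply: (continuous_comp (f := fun p : 'rV[R]_N * 'M[R]_(M, N) * R => p.1.2)
      (g := fun x : 'M[R]_(M, N) => x i j)); last exact: coord_continuous.
  by apply: continuous_comp; [exact: cvg_fst|exact: cvg_snd].
have cK : compact K.
  apply: compact_closedI.
    apply: compact_setX; last exact: segment_compact.
    by apply: compact_setX => //; exact: compact_simplex.
  apply: closed_bigI => -[A i] /= _; apply: closed_le_continuous.
    by move=> p; apply: cvgM; [exact: cvg_snd|exact: cf1].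
  apply: continuous_mulmx => k l; last by under eq_fun do rewrite mxE; exact: cf1.
  under eq_fun do rewrite mxE.
  move=> p; apply: cvgD; last exact: cvg_cst.
  have cA0 i0 j0 : continuous (fun _ : 'rV[R]_N * 'M[R]_(M, N) * R => A i0 j0).
    exact: cst_continuous.
  exact: (continuous_mulmx cA0 cf2).
have superK (x : 'cV[R]_N) B t : nonneg_mx x -> \sum_i x i 0 = 1 -> cB B ->
    0 <= t ->
    (forall A, cA A -> lemx (t *: x) ((A *m B + const_mx e) *m x)) ->
    K (x^T, B, t).
  move=> x0 x1 BB t0 tP; split.
    split; last by rewrite /= in_itv /= t0; apply: TP tP.
    split=> //; split=> [i j|] /=; first by rewrite mxE.
    by rewrite -[RHS]x1; apply: eq_bigr => i _; rewrite mxE.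
  by move=> [A i] /= AA; have := tP _ AA i 0; rewrite trmxK mxE [x^T _ _]mxE.
have [B0 BB0 _] := iru_argmax (0 : 'cV_N) iruB compactB.
have nonnegC A B : cA A -> cB B -> nonneg_mx (A *m B + const_mx e).
  move=> AA BB i j; rewrite mxE addr_ge0 //; last by rewrite mxE ltW.
  by apply: nonneg_mulmx; [exact: nonnegA|exact: nonnegB].
have K0 : K !=set0.
  (* The uniform vector at level 0 meets all constraints. *)
  exists ((const_mx N%:R^-1)^T, B0, 0); apply: superK => //.
  - by move=> i j; rewrite mxE invr_ge0.
  - rewrite (eq_bigr (fun=> N%:R^-1)) => [|i _]; last by rewrite mxE.
    by rewrite sumr_const card_ord -[_ *+ N]mulr_natr mulVf // pnatr_eq0 -lt0n.
  - move=> A AA i j; rewrite scale0r mxE; apply: nonneg_mulmx => [|k l].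
      exact: nonnegC.
    by rewrite mxE invr_ge0.
have [] := @compact_EVT_max _ R
  (fun p : 'rV[R]_N * 'M[R]_(M, N) * R => p.2) K K0 cK.
  by apply: continuous_subspaceT => p; exact: cvg_snd.
move=> [[x' B] t] xBt maxt; move: xBt; rewrite inE => -[[[[/= x'0 x'1] BB]]].
rewrite /= in_itv /= => /andP[t0 _] xP.
pose x := x'^T.
have x0 : nonneg_mx x by move=> i j; rewrite mxE.
have x1 : \sum_i x i 0 = 1.
  by rewrite -[RHS]x'1; apply: eq_bigr => i _; rewrite mxE.
have {}xP A : cA A -> lemx (t *: x) ((A *m B + const_mx e) *m x).
  by move=> AA i j; rewrite [j]ord1 mxE [x i 0]mxE; exact: (xP (A, i) AA).
have {}maxt (z : 'cV[R]_N) B' (t' : R) : nonneg_mx z -> \sum_i z i 0 = 1 -> cB B' -> 0 <= t' ->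
    (forall A, cA A -> lemx (t' *: z) ((A *m B' + const_mx e) *m z)) -> t' <= t.
  move=> z0 z1 BB' t'0 zP; have /= := maxt (z^T, B', t'); apply.
  by rewrite inE; exact: superK.
(* [B1] replaces [B], which is not known to maximize the coordinates of [B *m x]. *)
have [B1 BB1 B1P] := iru_argmax x iruB compactB.
have [A1 AA1 A1P] := iru_argmin (B1 *m x) iruA compactA.
pose y := (A1 *m B1 + const_mx e) *m x.
have txy : lemx (t *: x) y.
  apply: lemx_trans (xP _ AA1) _ => i j; rewrite /y !mulmxDl [leLHS]mxE [leRHS]mxE lerD2r.
  by rewrite -!mulmxA; apply: lemx_mul2l; [exact: nonnegA|exact: B1P].
have ypos i : 0 < y i 0.
  rewrite /y mulmxDl mxE mul_const_mx_cV x1 mulr1 ltr_wpDl //.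
  by do 2! [apply: nonneg_mulmx => //]; [exact: nonnegA|exact: nonnegB].
pose Y := \sum_i y i 0.
have Y0 : 0 < Y.
  rewrite /Y (bigD1 (Ordinal hN)) //= ltr_pwDl // sumr_ge0 // => i _.
  exact: ltW.
have txY : t <= Y.
  rewrite -[t]mulr1 -x1 mulr_sumr ler_sum // => i _.
  by have := txy i 0; rewrite mxE.
have A1min A : cA A -> lemx (A1 *m B1 *m x) (A *m B1 *m x).
  by move=> AA; rewrite -!mulmxA; exact: A1P.
have yE : y = t *: x.
  (* The entries of [y - t *: x] are non-negative with sum [Y - t], so [Y <= t] makes them all
     vanish. *)
  suff Yt : Y <= t.
    have Y1 : Y = t by apply/eqP; rewrite eq_le Yt txY.
    apply/matrixP => i j; rewrite ord1 [RHS]mxE; apply/eqP.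
    have : \sum_i (y i 0 - t * x i 0) == 0.
      by rewrite sumrB -mulr_sumr x1 mulr1 -/Y Y1 subrr.
    rewrite psumr_eq0; last by move=> k _; have := txy k 0; rewrite mxE subr_ge0.
    by move=> /allP/(_ i (mem_index_enum _)); rewrite subr_eq0.
  (* On [y] the constant matrix contributes [e * Y], against the [t * e] contained in [t * y i 0].
     The surplus [e * (Y - t)], divided by [Y >= y i 0], is the gain in level available at
     [Y^-1 *: y]; maximality of [t] forces it to be at most 0. *)
  have d0 : 0 <= e * (Y - t) / Y.
    by rewrite mulr_ge0 ?invr_ge0 ?(ltW Y0) // mulr_ge0 ?(ltW e0) // subr_ge0.
  suff : t + e * (Y - t) / Y <= t.
    by rewrite gerDl pmulr_lle0 ?invr_gt0 // pmulr_rle0 // subr_le0.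
  apply: (maxt (Y^-1 *: y) B1) => //.
  - by move=> i j; rewrite mxE [j]ord1 mulr_ge0 ?invr_ge0 ?ltW.
  - by under eq_bigr do rewrite mxE; rewrite -mulr_sumr -/Y mulVf ?gt_eqF.
  - by rewrite addr_ge0.
  move=> A AA i j; rewrite [j]ord1 scalerA mulrC -scalerA -scalemxAr mxE.
  rewrite [leRHS]mxE ler_pM2l ?invr_gt0 // mulmxDl mxE [leRHS]mxE.
  rewrite mul_const_mx_cV -/Y mulrDl.
  have ABy : t * (A1 *m B1 *m x) i 0 <= (A *m B1 *m y) i 0.
    apply: (@le_trans _ _ (t * (A *m B1 *m x) i 0)).
      by rewrite ler_wpM2l //; exact: A1min.
    have -> : t * (A *m B1 *m x) i 0 = (A *m B1 *m (t *: x)) i 0.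
      by rewrite -scalemxAr [RHS]mxE.
    by apply: lemx_mul2l txy i 0;
      apply: nonneg_mulmx; [exact: nonnegA|exact: nonnegB].
  have yi : y i 0 = (A1 *m B1 *m x) i 0 + e.
    by rewrite /y mulmxDl mxE mul_const_mx_cV x1 mulr1.
  have yY : e * (Y - t) / Y * y i 0 <= e * (Y - t).
    rewrite -mulrA ler_piMr //; first by rewrite mulr_ge0 ?subr_ge0 // ltW.
    rewrite mulrC ler_pdivrMr // mul1r /Y (bigD1 i) //= lerDl sumr_ge0 // => k _.
    exact: ltW.
  rewrite {1}yi; lra.
exists A1, B1, x, t; do !split => //.
move=> i; rewrite lt_neqAle x0 andbT eq_sym; apply/eqP => xi0.
by have := ypos i; rewrite yE mxE xi0 mulr0 ltxx.
Qed.

(** * Letting the perturbation tend to 0 *)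

Lemma cluster_closed (T : topologicalType) (u : nat -> T) (p : T) (C : set T) :
  cluster (u @ \oo) p -> closed C -> (\forall n \near \oo, C (u n)) -> C p.
Proof.
move=> up cC Cu; apply: cC => V Vp; exact: up Cu Vp.
Qed.

(** For each [d > 0] the error is eventually below [d], so the closed condition [f <= g + d] passes
    to the cluster point without extracting a subsequence. *)
Lemma cluster_le (R : realType) (T : topologicalType) (u : nat -> T) (p : T)
  (f g : T -> R) :
  cluster (u @ \oo) p -> continuous f -> continuous g ->
  (forall n, f (u n) <= g (u n) + n.+1%:R^-1) -> f p <= g p.
Proof.
move=> up cf cg fg; apply/ler_addgt0Pl => d d0; rewrite addrC.
apply: (@cluster_closed _ u p [set t | f t <= g t + d] up).
  apply: closed_le_continuous => // t.
  by apply: cvgD; [exact: cg|exact: cvg_cst].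
near=> n; apply: le_trans (fg n) _; rewrite lerD2l ltW //; near: n.
exact: near_infty_natSinv_lt (PosNum d0).
Unshelve. all: by end_near. Qed.

Lemma pairing_gt0 (R : realType) (n : nat) (u : 'rV[R]_n) (x : 'cV[R]_n) :
  nonneg_mx u -> u != 0 -> (forall i, 0 < x i 0) -> 0 < (u *m x) 0 0.
Proof.
move=> u0 un0 x0; have /rV0Pn[i ui] := un0.
rewrite mxE (bigD1 i) //= ltr_pwDl //.
  by rewrite mulr_gt0 // lt_neqAle eq_sym ui u0.
by rewrite sumr_ge0 // => k _; rewrite mulr_ge0 // ltW.
Qed.

(* Let the perturbation tend to 0 along a cluster point. The eigenvector may lose
   positivity in the limit, so the bound over [cB] is expressed by left
   subeigenvectors [u]: on the support of [u] a strict inequality persists at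
   nearby perturbed matrices, and off the support it is trivial. *)
Lemma limit_saddle (R : realType) (N M : nat) (hN : (0 < N)%N)
  (cA : set 'M[R]_(N, M)) (cB : set 'M[R]_(M, N))
  (iruA : is_iru_set cA) (iruB : is_iru_set cB)
  (compactA : compact cA) (compactB : compact cB)
  (nonnegA : forall A, cA A -> nonneg_mx A)
  (nonnegB : forall B, cB B -> nonneg_mx B) :
  exists A B (x : 'cV[R]_N) (t : R),
    [/\ [/\ cA A, cB B & 0 <= t],
        nonneg_mx x /\ x != 0,
        A *m B *m x = t *: x,
        forall A', cA A' -> lemx (t *: x) (A' *m B *m x) &
        forall B', cB B' -> forall (u : 'rV[R]_N) (r : R), nonneg_mx u ->
          u != 0 -> lemx (r *: u) (u *m (A *m B')) -> r <= t].
Proof.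
have [T TP] := superlevel_bounded iruA iruB compactA compactB nonnegA nonnegB.
pose E := ('M[R]_(N, M) * 'M[R]_(M, N) * 'rV[R]_N * R)%type.
pose S := [set x : 'rV[R]_N | nonneg_mx x /\ \sum_i x 0 i = 1].
pose K : set E := cA `*` cB `*` S `*` `[0, T]%classic.
pose e (n : nat) : R := n.+1%:R^-1.
have e0 n : 0 < e n by rewrite invr_gt0.
have e1 n : e n <= 1 by rewrite invf_le1 // ler1n.
have nonnegP A B : cA A -> cB B -> nonneg_mx (A *m B).
  by move=> AA BB; apply: nonneg_mulmx; [exact: nonnegA|exact: nonnegB].
(* [w n] is a saddle point for the perturbation [e n]; as the entries of the eigenvector sum to 1,
   the perturbation adds exactly [e n] to each coordinate. *)
have /choice[w wP] (n : nat) : exists p : E,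
    [/\ K p,
        forall i, 0 < p.1.2 0 i,
        forall i, (p.1.1.1 *m p.1.1.2 *m p.1.2^T) i 0 + e n = p.2 * p.1.2 0 i,
        forall A', cA A' ->
          lemx (p.1.1.1 *m p.1.1.2 *m p.1.2^T) (A' *m p.1.1.2 *m p.1.2^T) &
        forall B', cB B' -> lemx (B' *m p.1.2^T) (p.1.1.2 *m p.1.2^T)].
  have [A [B [x [t [[[AA BB t0] x0 x1 xE] [AP BP]]]]]] :=
    perturbed_saddle hN iruA iruB compactA compactB nonnegA nonnegB (e0 n) (e1 n).
  have xnn : nonneg_mx x by move=> i j; rewrite [j]ord1 ltW.
  exists (A, B, x^T, t); split; rewrite /= ?trmxK => //.
  - split; last first.
      rewrite /= in_itv /= t0; apply: (TP _ _ _ _ (e1 n) xnn x1 BB) => A' AA'.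
      rewrite -xE !mulmxDl => i j; rewrite [leLHS]mxE [leRHS]mxE lerD2r.
      exact: AP.
    split=> //; split=> /= [i j|]; first by rewrite mxE.
    by rewrite -[RHS]x1; apply: eq_bigr => i _; rewrite mxE.
  - by move=> i; rewrite mxE.
  - move=> i; have /matrixP/(_ i 0) := xE.
    by rewrite mulmxDl mxE mul_const_mx_cV x1 mulr1 [RHS]mxE [x^T _ _]mxE.
have cK : compact K.
  apply: compact_setX; last exact: segment_compact.
  by apply: compact_setX; [exact: compact_setX|exact: compact_simplex].
have KF : (w @ \oo) K by exists 0%N => // n _; have [] := wP n.
have [p [Kp wp]] := cK (w @ \oo) _ KF.
have cA0 i j : continuous (fun q : E => q.1.1.1 i j).
  move=> q; apply: (continuous_comp (f := fun q : E => q.1.1.1)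
      (g := fun x : 'M[R]_(N, M) => x i j)); last exact: coord_continuous.
  apply: continuous_comp; last exact: cvg_fst.
  by apply: continuous_comp; exact: cvg_fst.
have cB0 i j : continuous (fun q : E => q.1.1.2 i j).
  move=> q; apply: (continuous_comp (f := fun q : E => q.1.1.2)
      (g := fun x : 'M[R]_(M, N) => x i j)); last exact: coord_continuous.
  apply: continuous_comp; last exact: cvg_snd.
  by apply: continuous_comp; exact: cvg_fst.
have cx i j : continuous (fun q : E => q.1.2^T i j).
  under eq_fun do rewrite mxE.
  move=> q; apply: (continuous_comp (f := fun q : E => q.1.2)
      (g := fun x : 'rV[R]_N => x j i)); last exact: coord_continuous.
  by apply: continuous_comp; [exact: cvg_fst|exact: cvg_snd].
have ct : continuous (fun q : E => q.2) by move=> q; exact: cvg_snd.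
have ctx i : continuous (fun q : E => q.2 * q.1.2 0 i).
  have := cx i 0; under eq_fun do rewrite mxE.
  by move=> ci q; apply: cvgM; [exact: ct|exact: ci].
have cst m n (C : 'M[R]_(m, n)) i j : continuous (fun _ : E => C i j).
  exact: cst_continuous.
exists p.1.1.1, p.1.1.2, p.1.2^T, p.2.
case: Kp => -[[AA BB] [x0 x1]]; rewrite /= in_itv /= => /andP[t0 _].
split=> //.
- split; first by move=> i j; rewrite mxE.
  (* The coordinate sum 1 survives in the limit and excludes the zero vector. *)
  apply/eqP => xT0; move: x1; rewrite -[p.1.2]trmxK xT0 big1 => [/eqP|i _].
    by rewrite eq_sym oner_eq0.
  by rewrite !mxE.
- have cABx := continuous_mulmx (continuous_mulmx cA0 cB0) cx.
  apply/matrixP => i j; rewrite [j]ord1 [RHS]mxE [p.1.2^T i 0]mxE.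
  apply/eqP; rewrite eq_le; apply/andP; split.
    apply: (cluster_le wp (cABx i 0) (ctx i)) => n.
    by have [_ _ <- _ _] := wP n; rewrite -addrA lerDl addr_ge0 // ltW ?invr_gt0.
  apply: (cluster_le wp (ctx i) (cABx i 0)) => n.
  by have [_ _ <- _ _] := wP n.
- move=> A' AA' i j; rewrite [j]ord1 [leLHS]mxE [p.1.2^T i 0]mxE.
  have cA'Bx := continuous_mulmx (continuous_mulmx (cst _ _ A') cB0) cx.
  apply: (cluster_le wp (ctx i) (cA'Bx i 0)) => n.
  have [_ _ <- AP _] := wP n; rewrite lerD2r; exact: AP.
move=> B' BB' u r u0 un0 ur; rewrite leNgt; apply/negP => tr.
(* The midpoint satisfies [p.2 < s < r]. Near [p] the level stays below [s], while on the support of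
   [u] the subeigenvector inequality holds strictly with factor [s], because [s * u 0 j < r * u 0 j]
   there. *)
pose s := (r + p.2) / 2.
have uV : nbhs p [set q : E | q.2 < s /\
    forall j, 0 < u 0 j -> s * u 0 j < (u *m (q.1.1.1 *m B')) 0 j].
  have cuV := continuous_mulmx (cst _ _ u) (continuous_mulmx cA0 (cst _ _ B')).
  near=> q; split; near: q.
    by apply: (cvgr_lt p.2); [exact: ct|rewrite /s; lra].
  apply: filter_forall => j.
  have [uj|uj] := ltP 0 (u 0 j); last exact: filterE.
  near=> q => _; near: q.
  apply: (cvgr_gt ((u *m (p.1.1.1 *m B')) 0 j)); first exact: cuV.
  have := ur 0 j; rewrite mxE; apply: lt_le_trans.
  by rewrite ltr_pM2r // /s; lra.
(* Meeting the range of [w] gives an actual index [n], where the eigenvector is still strictly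
   positive. *)
have rangeF : (w @ \oo) (range w) by exists 0%N => // n _; exists n.
have [q [[n _ <-] [ts sP]]] := wp _ _ rangeF uV.
have [[[[AAn BBn] _] _] xn xnE _ BPn] := wP n.
set An' := (w n).1.1.1 in AAn ts sP xnE BPn *.
pose x := (w n).1.2^T.
have xpos i : 0 < x i 0 by rewrite mxE.
have xnn : nonneg_mx x by move=> i j; rewrite [j]ord1 ltW.
have ux := pairing_gt0 u0 un0 xpos.
have le1 : lemx (s *: u) (u *m (An' *m B')).
  move=> i j; rewrite (ord1 i) mxE.
  have := u0 0 j; rewrite le_eqVlt => /orP[/eqP <-|]; last by move=> /sP/ltW.
  rewrite mulr0; apply: nonneg_mulmx => //; exact: nonnegP.
have le2 : lemx (u *m (An' *m B') *m x) ((w n).2 *: (u *m x)).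
  rewrite scalemxAr -mulmxA; apply: lemx_mul2l => // i j.
  rewrite [j]ord1 [leRHS]mxE [x i 0]mxE -xnE ler_wpDr ?(ltW (e0 n)) // -!mulmxA.
  by apply: lemx_mul2l; [exact: nonnegA|exact: BPn].
(* Both bounds are multiples of the positive number [u *m x]; cancelling it leaves [s <= (w n).2],
   against [(w n).2 < s]. *)
have := lemx_trans (lemx_mul2r xnn le1) le2 0 0.
rewrite -scalemxAl mxE [leRHS]mxE ler_pM2r // => st.
by have := lt_le_trans ts st; rewrite ltxx.
Unshelve. all: by end_near. Qed.

(** * Perron theory of a single non-negative matrix *)

Lemma nonneg_right_eigenvector (R : realType) (n : nat) (hn : (0 < n)%N)
  (X : 'M[R]_n) : nonneg_mx X ->
  exists (x : 'cV[R]_n) (t : R),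
    [/\ 0 <= t, nonneg_mx x, x != 0, X *m x = t *: x &
        forall (u : 'rV[R]_n) (r : R), nonneg_mx u -> u != 0 ->
          lemx (r *: u) (u *m X) -> r <= t].
Proof.
move=> X0.
have n1 : nonneg_mx (1%:M : 'M[R]_n) by move=> i j; rewrite mxE ler0n.
have [A [B [x [t]]]] := @limit_saddle R n n hn [set X] [set 1%:M]
  (is_iru_set1 X) (is_iru_set1 _) (@compact_set1 _ _) (@compact_set1 _ _)
  (fun A (AX : A = X) => eq_ind_r _ X0 AX)
  (fun B (B1 : B = 1%:M) => eq_ind_r _ n1 B1).
move=> [[-> -> t0] [x0 xn0] + _ /(_ _ erefl) uP]; rewrite mulmx1 => Xx.
by exists x, t; split=> // u r u0 un0; have := uP u r u0 un0; rewrite mulmx1.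
Qed.

Lemma normc_sum (R : realType) (n : nat) (F : 'I_n -> R[i]) :
  ComplexField.Normc.normc (\sum_i F i) <=
  \sum_i ComplexField.Normc.normc (F i).
Proof.
elim/big_ind2: _ => [|x a y b xa yb|//]; first by rewrite ComplexField.Normc.normc0.
by apply: le_trans (lerD xa yb); exact: le_normcD.
Qed.

Lemma normc_ge0 (R : realType) (z : R[i]) : 0 <= ComplexField.Normc.normc z.
Proof. by case: z => a b; exact: sqrtr_ge0. Qed.

Lemma normc_real (R : realType) (a : R) :
  0 <= a -> ComplexField.Normc.normc (real_complex R a) = a.
Proof. by move=> a0; rewrite /= expr0n addr0 sqrtr_sqr ger0_norm. Qed.

(** The Perron roots of [X] and [X^T] bound each other, hence agree. The common root is an
    eigenvalue and dominates the modulus of every other one, so the maximum defining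
    [spectral_radius] is attained there. *)
Lemma spectral_radius_perron (R : realType) (n : nat) (hn : (0 < n)%N)
  (X : 'M[R]_n) : nonneg_mx X ->
  exists2 y : 'rV[R]_n,
    [/\ nonneg_mx y, y != 0 & y *m X = spectral_radius X *: y] &
    forall (x : 'cV[R]_n) (r : R), nonneg_mx x -> x != 0 ->
      lemx (r *: x) (X *m x) -> r <= spectral_radius X.
Proof.
move=> X0.
have XT0 : nonneg_mx X^T by move=> i j; rewrite mxE.
have [x [t [t0 x0 xn0 Xx uP]]] := nonneg_right_eigenvector hn X0.
have [y [s [s0 y0 yn0 Xy vP]]] := nonneg_right_eigenvector hn XT0.
have yX : y^T *m X = s *: y^T by rewrite -[X]trmxK -trmx_mul Xy linearZ.
(* Each root's bound on subeigenvectors is tested on the eigenvector of the other. *)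
have ts : t = s.
  apply/eqP; rewrite eq_le; apply/andP; split.
    apply: (vP x^T); rewrite ?trmx_eq0 //; first by move=> i j; rewrite mxE.
    by rewrite -trmx_mul Xx linearZ.
  apply: (uP y^T); rewrite ?trmx_eq0 ?yX //.
  by move=> i j; rewrite mxE.
subst s.
have rhoE : spectral_radius X = t.
  apply: set_maxE; split.
    exists (real_complex R t); last exact: normc_real.
    apply/eigenvalueP; exists (map_mx (real_complex R) y^T).
      by rewrite -map_mxM yX map_mxZ.
    by rewrite map_mx_eq0 trmx_eq0.
  (* [eigenvalue] refers to row eigenvectors, so by the triangle inequality the entrywise modulus of
     [v] is a left subeigenvector for the modulus of [z], and [uP] applies. *)
  move=> _ [z /eigenvalueP[v vX vn0] <-].
  apply: (uP (map_mx (@ComplexField.Normc.normc R) v)).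
  - by move=> i j; rewrite mxE normc_ge0.
  - apply: contra vn0 => /eqP/matrixP v0; apply/eqP/matrixP => i j.
    by have := v0 i j; rewrite !mxE => /ComplexField.Normc.eq0_normc.
  move=> i j; rewrite (ord1 i) mxE [X in _ * X]mxE -ComplexField.Normc.normcM.
  have := vX => /matrixP/(_ 0 j); rewrite [in RHS]mxE => <-.
  rewrite mxE; apply: le_trans (normc_sum _) _; rewrite mxE ler_sum // => k _.
  by rewrite ComplexField.Normc.normcM !mxE normc_real.
rewrite rhoE; exists y^T.
  by split; rewrite ?trmx_eq0 // => i j; rewrite mxE.
move=> w r w0 wn0 rw; apply: (vP w^T); rewrite ?trmx_eq0 //.
  by move=> i j; rewrite mxE.
by move=> i j; have := rw j i; rewrite -trmx_mul [leLHS]mxE [in X in _ -> X]mxE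
  [w^T _ _]mxE [in X in _ -> X]mxE.
Qed.

(** * Saddle point of the spectral radius and minimax equality *)

(** The level [t] separates the two sides: a left Perron vector of [A *m B'] is an admissible [u],
    so its spectral radius is at most [t], and [x] is a right subeigenvector of [A' *m B], whose
    spectral radius is thus at least [t]. *)
Lemma spectral_saddle (R : realType) (N M : nat) (hN : (0 < N)%N)
  (cA : set 'M[R]_(N, M)) (cB : set 'M[R]_(M, N))
  (iruA : is_iru_set cA) (iruB : is_iru_set cB)
  (compactA : compact cA) (compactB : compact cB)
  (nonnegA : forall A, cA A -> nonneg_mx A)
  (nonnegB : forall B, cB B -> nonneg_mx B) :
  exists A B, [/\ cA A, cB B,
    forall A', cA A' -> spectral_radius (A *m B) <= spectral_radius (A' *m B) &
    forall B', cB B' -> spectral_radius (A *m B') <= spectral_radius (A *m B)].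
Proof.
have [A [B [x [t [[AA BB t0] [x0 xn0] ABx AP BP]]]]] :=
  limit_saddle hN iruA iruB compactA compactB nonnegA nonnegB.
have nonnegP A' B' : cA A' -> cB B' -> nonneg_mx (A' *m B').
  by move=> ? ?; apply: nonneg_mulmx; [exact: nonnegA|exact: nonnegB].
have le_t B' : cB B' -> spectral_radius (A *m B') <= t.
  move=> BB'; have [y [y0 yn0 yE] _] := spectral_radius_perron hN (nonnegP _ _ AA BB').
  by apply: (BP _ BB' y); rewrite ?yE.
have ge_t A' : cA A' -> t <= spectral_radius (A' *m B).
  move=> AA'; have [y _ xP] := spectral_radius_perron hN (nonnegP _ _ AA' BB).
  by apply: (xP x) => //; exact: AP.
exists A, B; split; [exact: AA|exact: BB| |].
  by move=> A' AA'; apply: (@le_trans _ _ t); [exact: le_t|exact: ge_t].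
by move=> B' BB'; apply: (@le_trans _ _ t); [exact: le_t|exact: ge_t].
Qed.

Theorem theorem8 (R : realType) (N M : nat) (hN : (0 < N)%N) (hM : (0 < M)%N)
  (cA : set 'M[R]_(N, M)) (cB : set 'M[R]_(M, N))
  (iruA : is_iru_set cA) (iruB : is_iru_set cB)
  (compactA : compact cA) (compactB : compact cB)
  (nonnegA : forall A, cA A -> nonneg_mx A)
  (nonnegB : forall B, cB B -> nonneg_mx B) :
  (* all the extrema in the equality below are attained *)
  [/\ forall A, cA A -> has_max [set spectral_radius (A *m B) | B in cB],
      has_min [set set_max [set spectral_radius (A *m B) | B in cB] | A in cA],
      forall B, cB B -> has_min [set spectral_radius (A *m B) | A in cA],
      has_max [set set_min [set spectral_radius (A *m B) | A in cA] | B in cB]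
    & set_min [set set_max [set spectral_radius (A *m B) | B in cB] | A in cA] =
      set_max [set set_min [set spectral_radius (A *m B) | A in cA] | B in cB]].
Proof.
(* The inner extrema are the saddle points with one set reduced to a point. *)
have maxB A : cA A -> has_max [set spectral_radius (A *m B) | B in cB].
  move=> AA; have [A' [B [-> BB _ BP]]] := @spectral_saddle R N M hN [set A] cB
    (is_iru_set1 A) iruB (@compact_set1 _ _) compactB
    (fun A' (AE : A' = A) => eq_ind_r _ (nonnegA _ AA) AE) nonnegB.
  by exists (spectral_radius (A *m B)); split=> [|_ [B' BB' <-]]; [exists B|exact: BP].
have minA B : cB B -> has_min [set spectral_radius (A *m B) | A in cA].
  move=> BB; have [A [B' [AA -> AP _]]] := @spectral_saddle R N M hN cA [set B]
    iruA (is_iru_set1 B) compactA (@compact_set1 _ _) nonnegA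
    (fun B' (BE : B' = B) => eq_ind_r _ (nonnegB _ BB) BE).
  by exists (spectral_radius (A *m B)); split=> [|_ [A' AA' <-]]; [exists A|exact: AP].
have [A [B [AA BB AP BP]]] :=
  spectral_saddle hN iruA iruB compactA compactB nonnegA nonnegB.
set v := spectral_radius (A *m B).
have minmax :
    is_min [set set_max [set spectral_radius (A *m B) | B in cB] | A in cA] v.
  split.
    exists A => //; apply: set_maxE.
    by split=> [|_ [B' BB' <-]]; [exists B|exact: BP].
  (* Attainment ensures that [set_max] is the true maximum here and not its default value 0. *)
  move=> _ [A' AA' <-]; have [w wP] := maxB _ AA'; rewrite (set_maxE wP).
  by apply: le_trans (AP _ AA') _; apply: wP.2; exists B.
have maxmin :
    is_max [set set_min [set spectral_radius (A *m B) | A in cA] | B in cB] v.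
  split.
    exists B => //; apply: set_minE.
    by split=> [|_ [A' AA' <-]]; [exists A|exact: AP].
  move=> _ [B' BB' <-]; have [w wP] := minA _ BB'; rewrite (set_minE wP).
  by apply: le_trans (BP _ BB'); apply: wP.2; exists A.
split=> //; [by exists v|by exists v|].
by rewrite (set_minE minmax) (set_maxE maxmin).
Qed.
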